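(* Let $k \geq 2$ and $n > \frac{k(k-1)}{\sqrt{8k}-1}$ be integers. Any nonempty partial $k$-star decomposition of $K_n$ can be embedded in a $k$-star decomposition of $K_{n+s}$ for each integer $s \geq k$ such that $\binom{n+s}{2} \equiv 0 \pmod{k}$.
   Context: All graphs are finite and simple. A $k$-star is a complete bipartite graph $K_{1,k}$. A $k$-star decomposition of a graph $G$ is a set of $k$-stars that are subgraphs of $G$ such that each edge of $G$ is in exactly one of the $k$-stars. A partial $k$-star decomposition of $G$ is a set of $k$-stars that are subgraphs of $G$ such that each edge of $G$ is in at most one of the $k$-stars; it is nonempty if it contains at least one $k$-star. An embedding of a partial $k$-star decomposition $\mathcal{A}$ of a graph $G$ is a partial $k$-star decomposition $\mathcal{B}$ of a graph $H$ such that $\mathcal{A} \subseteq \mathcal{B}$ and $G$ is a subgraph of $H$; we then say $\mathcal{A}$ is embedded in $\mathcal{B}$. $K_m$ denotes the complete graph on $m$ vertices. *)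

(* Defs.v *)
From HB Require Import structures.
From mathcomp Require Import all_boot all_order all_algebra.

Set Implicit Arguments.
Unset Strict Implicit.
Unset Printing Implicit Defensive.

(* A finite simple graph whose vertices are drawn from the finite type T: the
   first component is the vertex set, the second the set of edges, which are
   two-element sets of vertices. *)
Definition graph_axiom (T : finType) (VE : {set T} * {set {set T}}) : bool :=
  [forall e in VE.2, (e \subset VE.1) && (#|e| == 2)].

Record graph (T : finType) := Graph {
  graph_val : {set T} * {set {set T}};
  _ : graph_axiom graph_val }.

(* The finType structure makes {set graph T} available. *)
HB.instance Definition _ (T : finType) := [isSub for @graph_val T].
HB.instance Definition _ (T : finType) := [Finite of graph T by <:].

Definition vertices (T : finType) (G : graph T) : {set T} := (graph_val G).1.
Definition edges (T : finType) (G : graph T) : {set {set T}} := (graph_val G).2.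

Definition subgraph (T : finType) (G H : graph T) : Prop :=
  vertices G \subset vertices H /\ edges G \subset edges H.

Lemma complete_graph_subproof (T : finType) (U : {set T}) :
  graph_axiom (U, [set e : {set T} | (e \subset U) && (#|e| == 2)]).
Proof. by apply/forall_inP => e; rewrite inE. Qed.

Definition complete_graph (T : finType) (U : {set T}) : graph T :=
  Graph (complete_graph_subproof U).

Definition is_complete_bipartite (T : finType) (a b : nat) (S : graph T) : Prop :=
  exists X Y : {set T},
    [/\ [disjoint X & Y], #|X| = a, #|Y| = b, vertices S = X :|: Y
      & edges S = [set [set x; y] | x in X, y in Y]].

Definition is_star (T : finType) (k : nat) (S : graph T) : Prop :=
  is_complete_bipartite 1 k S.

Definition partial_star_decomposition (T : finType) (k : nat) (G : graph T)
    (A : {set graph T}) : Prop :=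
  (forall S, S \in A -> is_star k S /\ subgraph S G) /\
  (forall e, e \in edges G -> #|[set S in A | e \in edges S]| <= 1).

Definition star_decomposition (T : finType) (k : nat) (G : graph T)
    (A : {set graph T}) : Prop :=
  (forall S, S \in A -> is_star k S /\ subgraph S G) /\
  (forall e, e \in edges G -> #|[set S in A | e \in edges S]| = 1).

Definition is_embedding (T : finType) (k : nat)
    (G : graph T) (A : {set graph T}) (H : graph T) (B : {set graph T}) : Prop :=
  [/\ partial_star_decomposition k H B, A \subset B & subgraph G H].

(* Main.v *)
Require Import Defs.
From mathcomp Require Import all_boot all_order all_algebra zify ring lra.

Set Implicit Arguments.
Unset Strict Implicit.
Unset Printing Implicit Defensive.

Import Order.TTheory GRing.Theory Num.Theory.

(** Packing further k-stars greedily into the uncovered edges of K_n, one may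
    suppose that the leave L of the partial decomposition has maximum degree
    below k ([small_degree_leave]).  It remains to decompose the join G of L
    with K_s.

    A k-star decomposition of G amounts to an orientation of G in which every
    out-degree is a multiple of k: each vertex is the centre of stars made of
    its out-edges ([oriented_star_dec]).  An orientation with out-degrees at
    most d exists as soon as every vertex set S spans at most d(S) edges
    ([orientation]), so the task is to choose how many stars c(x) are centred
    at each vertex x, with k c(S) >= e(S) for all S and equality in total.

    Write e = |L|, n = |U| for the old vertices and s for the number of new
    ones, and put kK = e + ns + C(s,2), so that K stars are needed.
    - If K <= n + s, every vertex is the centre of one star, except for
      n + s - K old vertices that are centre of none; those must form an
      independent set of L, because an edge between two of them could not be
      oriented ([independent_dec]).  A greedy argument gives an independent
      set Z with m^2 |Z| + 2e >= (2m-1)n for every real m; this is the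
      tangent to the Turan bound |Z| >= n^2/(n + 2e) at average degree m - 1
      ([turan_tangent]).  At m = sqrt(2k) it reads
      e + k|Z| >= n (sqrt(2k) - 1/2), and the lower bound assumed on n is
      exactly what makes this exceed k(k-1)/2, so that Z is large enough.
    - If K > n + s, every old vertex is the centre of one star, and the
      K - n = qs + r other stars are spread as evenly as possible over the new
      vertices ([balanced_dec]).

    In both cases, let S have y old and j new vertices.  As the old part of S
    is kept fixed, the condition k c(S) >= e(S) becomes an inequality between a
    convex quadratic in j and the least number of stars centred at j new
    vertices, which is linear in j in the first case and has a single bend,
    at j = s - r, in the second.  So it suffices to check j = 0, j = s and the
    bend ([quadratic_between]).  At j = 0 it holds because L has small
    degrees, at j = s because the total number of stars is right, and the bend
    is [critical_size]. *)

(** * Edge sets *)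

Definition inner (T : finType) (E : {set {set T}}) (S : {set T}) :=
  [set e in E | e \subset S].

Definition edges_at (T : finType) (E : {set {set T}}) (x : T) :=
  [set e in E | x \in e].

Definition is_edge_set (T : finType) (E : {set {set T}}) :=
  forall e, e \in E -> #|e| = 2.

Section EdgeSets.

Variable T : finType.
Implicit Types (E F L : {set {set T}}) (U W Y Q Z : {set T}) (A B : {set graph T}).

Notation pairs U := (edges (complete_graph U)).

Lemma is_edge_setS E F : F \subset E -> is_edge_set E -> is_edge_set F.
Proof. by move=> /subsetP FE E2 e /FE; exact: E2. Qed.

Lemma edge_other E e x : is_edge_set E -> e \in E -> x \in e ->
  exists2 y, y != x & e = [set x; y].
Proof.
move=> E2 eE xe; have := E2 _ eE; rewrite (cardsD1 x) xe => -[/eqP/cards1P[y ey]].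
have : y \in e :\ x by rewrite ey set11.
by rewrite !inE => /andP[yx _]; exists y => //; rewrite -(setD1K xe) ey.
Qed.

Lemma set2_inj (x y z : T) : y != x -> [set x; y] = [set x; z] -> y = z.
Proof.
move=> yx /setP/(_ y); rewrite !inE eqxx orbT (negbTE yx) /= => /esym/eqP; exact.
Qed.

Lemma subset_card_eq (aT : finType) (A : {set aT}) m : m <= #|A| ->
  exists2 F : {set aT}, F \subset A & #|F| = m.
Proof.
move=> /card_geqP[s [us <- sA]]; exists [set x in s]; last by rewrite cardsE; apply/card_uniqP.
by apply/subsetP => x; rewrite inE; exact: sA.
Qed.

Lemma card_set_sum (aT : finType) (A : {set aT}) (P : pred aT) :
  #|[set x in A | P x]| = \sum_(x in A) P x.
Proof.
rewrite -sum1_card big_mkcond [RHS]big_mkcond; apply: eq_bigr => x _.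
by rewrite inE; case: (x \in A); case: (P x).
Qed.

Lemma handshake E (A : {set T}) : \sum_(x in A) #|edges_at E x| = \sum_(e in E) #|e :&: A|.
Proof.
under eq_bigr do rewrite card_set_sum.
rewrite exchange_big /=; apply: eq_bigr => e _.
by rewrite -card_set_sum; apply: eq_card => x; rewrite !inE andbC.
Qed.

Lemma in_pairs U e : (e \in pairs U) = (e \subset U) && (#|e| == 2).
Proof. by rewrite inE. Qed.

Lemma pairs_edge_set U : is_edge_set (pairs U).
Proof. by move=> e; rewrite in_pairs => /andP[_ /eqP]. Qed.

Lemma card_pairs U : #|pairs U| = 'C(#|U|, 2).
Proof. by rewrite -cards_draws. Qed.

Lemma pairsS U W : U \subset W -> pairs U \subset pairs W.
Proof. by move=> UW; apply/subsetP => e; rewrite !in_pairs => /andP[/subset_trans->]. Qed.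

Lemma double_bin2 j : 2 * 'C(j, 2) + j = j * j.
Proof. elim: j => // j IH; rewrite binS bin1; lia. Qed.

Lemma bin2D a b : 'C(a + b, 2) = 'C(a, 2) + a * b + 'C(b, 2).
Proof. have := double_bin2 (a + b); have := double_bin2 a; have := double_bin2 b; nia. Qed.

Lemma card_pairsD U W : U \subset W ->
  #|pairs W :\: pairs U| = #|U| * #|W :\: U| + 'C(#|W :\: U|, 2).
Proof.
move=> UW; rewrite cardsD (setIidPr (pairsS UW)) !card_pairs.
by rewrite -{1}(cardsID U W) (setIidPr UW) bin2D; lia.
Qed.

(** Double counting of the incidences between [A] and [F]. With [A] a vertex set
    meeting every edge of [F], [t = 1] applies; with [A] containing every edge
    of [F], [t = 2] does. *)
Lemma small_degree_bound k t L F (A : {set T}) :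
  (forall x, #|edges_at L x| < k) -> F \subset L ->
  (forall e, e \in F -> t <= #|e :&: A|) -> t * #|F| <= k.-1 * #|A|.
Proof.
move=> small FL tF; rewrite mulnC -sum_nat_const.
apply: (@leq_trans (\sum_(e in F) #|e :&: A|)); first exact: leq_sum.
rewrite -handshake mulnC -sum_nat_const.
apply: leq_sum => x _; have := small x.
have : #|edges_at F x| <= #|edges_at L x|.
  by apply/subset_leq_card/subsetP => e; rewrite !inE => /andP[/(subsetP FL)->].
lia.
Qed.

(** Greedy choice: take a vertex [v] of least degree [D] in the graph spanned by
    [S], delete its closed neighbourhood [N] and recurse.  This deletes at most
    [D + 1] vertices, all of degree at least [D], hence at least [|N| * D / 2]
    edges; the inequality survives since [(m - |N|) ^ 2 >= 0].  The bound is
    the tangent, for the parameter [m], of the convex Turan bound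
    [n ^ 2 / (n + 2 * e)], and so needs no division. *)
Lemma turan_tangent (R : realDomainType) (m : R) E (S : {set T}) : is_edge_set E ->
  exists Z : {set T}, [/\ Z \subset S, inner E Z = set0 &
    ((2 * m - 1) * #|S|%:R <= m * m * #|Z|%:R + 2 * #|inner E S|%:R)%R].
Proof.
move=> E2; move: {2}#|S| (leqnn #|S|) => c; elim: c S => [|c IH] S Sc.
  exists set0; rewrite sub0set; split=> //.
    apply/setP => e; rewrite !inE subset0; apply/negP => /andP[/E2 + /eqP e0].
    by rewrite e0 cards0.
  by move: Sc; rewrite leqn0 => /eqP->; rewrite cards0 !mulr0 add0r mulr_ge0.
have [S0|[v0 v0S]] := set_0Vmem S; first by apply: IH; rewrite S0 cards0.
pose ES := inner E S.
have [v vS vmin] := arg_minnP (fun v => #|edges_at ES v|) v0S.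
have {}vS : v \in S by exact: vS.
set D := #|edges_at ES v| in vmin.
pose N := v |: [set y in S | (y != v) && ([set v; y] \in E)].
have vN : v \in N by rewrite !inE eqxx.
have NS : N \subset S.
  by apply/subsetP => y; rewrite !inE => /orP[/eqP->//|/andP[]].
have ND : #|N| <= D.+1.
  rewrite cardsU1; set M := [set _ in _ | _].
  suff : #|M| <= D by case: (_ \notin _) => /=; lia.
  rewrite -(card_in_imset (_ : {in M &, injective (fun y => [set v; y])})).
    apply/subset_leq_card/subsetP => e /imsetP[y]; rewrite inE => /and3P[yS yv yE] ->.
    by rewrite !inE eqxx yE subUset !sub1set vS yS.
  by move=> y z; rewrite inE => /and3P[_ yv _] _; exact: set2_inj.
have [|Z [ZS Zi Zb]] := IH (S :\: N).
  have := cardsD S N; rewrite (setIidPr NS).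
  have : 0 < #|N| by apply/card_gt0P; exists v.
  lia.
have vZ : v \notin Z by apply/negP => /(subsetP ZS); rewrite !inE eqxx.
have lost : #|N| * D <= 2 * (#|ES| - #|inner E (S :\: N)|).
  have sub : inner E (S :\: N) \subset ES.
    by apply/subsetP => e; rewrite !inE => /andP[-> /subset_trans->//]; exact: subsetDl.
  have -> : #|ES| - #|inner E (S :\: N)| = #|ES :\: inner E (S :\: N)|.
    by rewrite cardsD (setIidPr sub).
  rewrite -sum_nat_const (leq_trans (n := \sum_(x in N) #|edges_at ES x|)) //.
    by apply: leq_sum => x /(subsetP NS); exact: vmin.
  rewrite handshake (bigID (mem (inner E (S :\: N)))) /= big1 ?add0n; last first.
    move=> e /andP[_]; rewrite !inE => /andP[_]; rewrite subsetD => /andP[_].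
    by rewrite disjoint_sym -setI_eq0 setIC => /eqP->; rewrite cards0.
  rewrite (eq_bigl (fun e => e \in ES :\: inner E (S :\: N))); last first.
    by move=> e; rewrite /= in_setD andbC.
  rewrite mulnC -sum_nat_const.
  apply: leq_sum => e; rewrite inE => /andP[_]; rewrite inE => /andP[eE _].
  by rewrite -(E2 _ eE) subset_leq_card // subsetIl.
exists (v |: Z); split.
- by rewrite subUset sub1set vS (subset_trans ZS) // subsetDl.
- apply/setP => e; rewrite [RHS]inE; apply/negP; rewrite inE => /andP[eE eZ].
  have [ve|ve] := boolP (v \in e).
    have [y yv ey] := edge_other E2 eE ve.
    have yZ : y \in Z.
      by have /(subsetP eZ) : y \in e; rewrite ?ey ?inE ?eqxx ?orbT // (negbTE yv).
    have := subsetP ZS _ yZ; rewrite !inE (negbTE yv) /= => /andP[+ yS].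
    by rewrite yS -ey eE.
  have : e \in inner E Z.
    rewrite inE eE /=; apply/subsetP => y ye; have := subsetP eZ _ ye.
    by rewrite !inE => /orP[/eqP yv|//]; rewrite -yv ye in ve.
  by rewrite Zi inE.
- have SN : #|S| = #|S :\: N| + #|N| by rewrite cardsD (setIidPr NS) subnK // subset_leq_card.
  rewrite cardsU1 vZ /= SN !natrD mulrDr mulrDr.
  have : #|N| * #|N| + 2 * #|inner E (S :\: N)| <= 2 * #|ES| + #|N|.
    have := leq_mul (leqnn #|N|) ND.
    have : #|inner E (S :\: N)| <= #|ES|.
      apply/subset_leq_card/subsetP => e; rewrite !inE.
      by move=> /andP[-> /subset_trans->//]; exact: subsetDl.
    lia.
  rewrite -(ler_nat R) !natrD !natrM -/ES.
  have := sqr_ge0 (m - #|N|%:R)%R; rewrite expr2; move: Zb.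
  move: (#|N|%:R)%R (#|S :\: N|%:R)%R (#|Z|%:R)%R (#|ES|%:R)%R (#|inner E (S :\: N)|%:R)%R.
  clear; move=> x1 x2 x3 x4 x5; lra.
Qed.

(** * Orientations with prescribed out-degrees *)

(** An orientation chooses the tail [f e] of each edge.  By induction on the edges:
    an edge [e0] can be given the tail [w] unless some set containing [w] is
    tight, that is, already spans as many of the other edges as its capacity.
    If both ends of [e0] are blocked by tight sets, then by supermodularity of
    the number of spanned edges their union spans all its capacity without
    counting [e0], which also lies in it; this contradicts the assumption.
    The vertex [x0] only serves to have a value of [f] outside [E]. *)
Lemma orientation (x0 : T) E (d : T -> nat) : is_edge_set E ->
  (forall S, #|inner E S| <= \sum_(x in S) d x) ->
  exists f : {set T} -> T, (forall e, e \in E -> f e \in e) /\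
    forall x, #|[set e in E | f e == x]| <= d x.
Proof.
move: {2}#|E| (leqnn #|E|) => m; elim: m E d => [|m IH] E d.
  rewrite leqn0 cards_eq0 => /eqP-> _ _; exists (fun=> x0).
  split=> [e|x]; first by rewrite inE.
  by rewrite eq_card0 // => e; rewrite !inE.
move=> Em E2 dE.
have [->|[e0 e0E]] := set_0Vmem E.
  apply: (IH set0) => [|e|S]; rewrite ?cards0 ?inE //.
  by rewrite eq_card0 // => e; rewrite !inE.
set E' := E :\ e0.
have E'2 : is_edge_set E' by apply: is_edge_setS E2; rewrite subD1set.
have E'm : #|E'| <= m by move: Em; rewrite (cardsD1 e0) e0E.
have innerE S : #|inner E S| = (e0 \subset S) + #|inner E' S|.
  rewrite (cardsD1 e0) !inE e0E /=; congr (_ + _); apply: eq_card => e.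
  by rewrite !inE andbA.
have step w : w \in e0 -> (forall S : {set T}, w \in S -> #|inner E' S| < \sum_(x in S) d x) ->
  exists f : {set T} -> T, (forall e, e \in E -> f e \in e) /\
    forall x, #|[set e in E | f e == x]| <= d x.
  move=> we0 H.
  have dw : 0 < d w by have := H [set w] (set11 w); rewrite big_set1; case: (d w).
  have [|f [fe fd]] := IH E' (fun x => d x - (x == w)) E'm E'2.
    move=> S; have [wS|wS] := boolP (w \in S).
      have := H S wS; rewrite (bigD1 w) //= [X in _ -> _ <= X](bigD1 w) //= eqxx.
      under [X in _ -> _ <= _ + X]eq_bigr => i /andP[_ /negbTE->] do rewrite subn0.
      lia.
    rewrite (eq_bigr d); first by have := dE S; rewrite innerE; lia.
    by move=> i iS; case: eqP => [iw|]; [rewrite -iw iS in wS | rewrite subn0].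
  exists (fun e => if e == e0 then w else f e); split=> [e eE|x].
    by case: eqVneq => [->//|ne]; apply: fe; rewrite !inE ne.
  rewrite (cardsD1 e0) !inE e0E eqxx /=.
  have := fd x; rewrite [w == x]eq_sym.
  have : #|[set e in E | (if e == e0 then w else f e) == x] :\ e0| =
         #|[set e in E' | f e == x]|.
    by apply: eq_card => e; rewrite !inE; case: eqP.
  move=> ->; case: eqP => [->|_]; lia.
have /eqP/cards2P[u [v [uv e0E2]]] := E2 _ e0E.
(* Either [w] may be the tail of [e0], or a tight set contains [w]. *)
have bad w : (forall S : {set T}, w \in S -> #|inner E' S| < \sum_(x in S) d x) \/
   exists2 S : {set T}, w \in S & \sum_(x in S) d x <= #|inner E' S|.
  have [/forallP H|/forallPn[S]] :=
    boolP [forall S : {set T}, (w \in S) ==> (#|inner E' S| < \sum_(x in S) d x)].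
    by left=> S; exact/implyP.
  by rewrite negb_imply -leqNgt => /andP[wS dS]; right; exists S.
have [|[Su uS du]] := bad u; first by apply: step; rewrite e0E2 !inE eqxx.
have [|[Sv vS dv]] := bad v; first by apply: step; rewrite e0E2 !inE eqxx orbT.
exfalso.
have sum_d : \sum_(x in Su :|: Sv) d x + \sum_(x in Su :&: Sv) d x =
   \sum_(x in Su) d x + \sum_(x in Sv) d x.
  rewrite (big_setID Su) /= setUK setDUl setDv set0U -addnA addnC [RHS]addnC; congr (_ + _).
  by rewrite [RHS](big_setID Su) /= setIC addnC.
have iI : inner E' Su :&: inner E' Sv = inner E' (Su :&: Sv).
  by apply/setP => e; rewrite !inE subsetI andbACA andbb.
have iU : #|inner E' Su :|: inner E' Sv| <= #|inner E' (Su :|: Sv)|.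
  apply/subset_leq_card/subsetP => e; rewrite !inE => /orP[] /andP[-> eS] /=;
    apply: subset_trans eS _; rewrite ?subsetUl ?subsetUr //.
have := cardsUI (inner E' Su) (inner E' Sv); rewrite iI.
have := dE (Su :|: Sv); rewrite innerE.
have -> : e0 \subset Su :|: Sv by rewrite e0E2 subUset !sub1set !inE uS vS orbT.
have := dE (Su :&: Sv); rewrite innerE; lia.
Qed.

(** * Star decompositions of edge sets *)

(** Decomposing bare edge sets, rather than graphs, lets decompositions of
    disjoint edge sets be united without keeping track of vertex sets. *)
Definition star_dec k E B :=
  (forall S, S \in B -> is_star k S /\ edges S \subset E) /\
  forall e, e \in E -> #|[set S in B | e \in edges S]| = 1.

Lemma star_dec0 k : star_dec k set0 set0.
Proof. by split=> [S|e]; rewrite inE. Qed.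

Lemma star_dec1 k (S : graph T) : is_star k S -> star_dec k (edges S) [set S].
Proof.
move=> kS; split=> [S'|e eS]; first by rewrite inE => /eqP->.
rewrite -[RHS](cards1 S); apply: eq_card => S'; rewrite !inE.
by case: eqP => // ->.
Qed.

Lemma star_decU k E1 E2 B1 B2 : [disjoint E1 & E2] ->
  star_dec k E1 B1 -> star_dec k E2 B2 -> star_dec k (E1 :|: E2) (B1 :|: B2).
Proof.
move=> dis [s1 c1] [s2 c2]; split=> [S|e].
  rewrite inE => /orP[/s1|/s2] [kS SE]; split=> //; apply: subset_trans SE _;
  by rewrite ?subsetUl ?subsetUr.
have out E E' B : [disjoint E & E'] -> (forall S, S \in B -> is_star k S /\ edges S \subset E') ->
    e \in E -> forall S, S \in B -> e \in edges S = false.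
  move=> dE sB eE S /sB[_ /subsetP SE]; apply/negP => /SE eE'.
  by have /pred0P/(_ e) := dE; rewrite /= eE eE'.
rewrite inE => /orP[eE|eE].
  rewrite -(c1 _ eE); apply: eq_card => S; rewrite !inE.
  have [SB2|] := boolP (S \in B2); last by rewrite orbF.
  by rewrite (out _ _ _ dis s2 eE) // !andbF.
rewrite -(c2 _ eE); apply: eq_card => S; rewrite !inE.
have [SB1|//] := boolP (S \in B1).
by rewrite disjoint_sym in dis; rewrite (out _ _ _ dis s1 eE) // !andbF.
Qed.

Lemma star_graph k x F : is_edge_set F -> (forall e, e \in F -> x \in e) -> #|F| = k ->
  exists S : graph T, is_star k S /\ edges S = F.
Proof.
move=> F2 xF Fk.
pose Y := [set y | (y != x) && ([set x; y] \in F)].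
have FY : F = [set [set x; y] | y in Y].
  apply/setP => e; apply/idP/imsetP => [eF|[y + ->]]; last by rewrite inE => /andP[].
  have [y yx ey] := edge_other F2 eF (xF _ eF).
  by exists y => //; rewrite inE yx -ey.
have ax : graph_axiom (x |: Y, F).
  apply/forall_inP => e /= eF; rewrite (F2 _ eF) eqxx andbT.
  have [y yx ey] := edge_other F2 eF (xF _ eF).
  by rewrite ey subUset !sub1set !inE eqxx yx -ey eF orbT.
exists (Graph ax); split=> //; exists [set x], Y; split.
- by rewrite disjoints1 inE eqxx.
- exact: cards1.
- rewrite -Fk FY card_in_imset // => y z; rewrite !inE => /andP[yx _] _.
  exact: set2_inj.
- by [].
- rewrite /edges /= {1}FY; apply/setP => e.
  apply/imsetP/imset2P => [[y yY ->]|[z y]]; first by exists x y; rewrite ?set11.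
  by rewrite inE => /eqP-> yY ->; exists y.
Qed.

Lemma star_cards k (S : graph T) : is_star k S -> #|edges S| = k /\ #|vertices S| = k.+1.
Proof.
case=> X [Y [dis /eqP/cards1P[x Xx] Yk VS ES]]; rewrite Xx in dis VS ES.
split; last by rewrite VS cardsU1 Yk; move: dis; rewrite disjoints1 => ->.
have xY : x \notin Y by rewrite disjoints1 in dis.
rewrite ES -Yk -(card_in_imset (_ : {in Y &, injective (fun y => [set x; y])})).
  apply: eq_card => e.
  apply/imset2P/imsetP => [[z y]|[y yY ->]]; last by exists x y; rewrite ?set11.
  by rewrite inE => /eqP-> yY ->; exists y.
by move=> y z yY _; apply: set2_inj; apply: contraNneq xY => <-.
Qed.

(** This is what recovers inclusions of vertex sets from inclusions of edge
    sets. *)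
Lemma mem_star_vertices k (S : graph T) x : 0 < k -> is_star k S -> x \in vertices S ->
  exists2 e, e \in edges S & x \in e.
Proof.
move=> k0 [X [Y [_ X1 Yk -> ->]]]; rewrite inE => /orP[xX|xY].
  have [Y0|[y yY]] := set_0Vmem Y; first by rewrite -Yk Y0 cards0 in k0.
  by exists [set x; y]; [exact: imset2_f | rewrite !inE eqxx].
have [X0|[z zX]] := set_0Vmem X; first by rewrite X0 cards0 in X1.
by exists [set z; x]; [exact: imset2_f | rewrite !inE eqxx orbT].
Qed.

Lemma star_dec_dvd k E B : star_dec k E B -> k %| #|E|.
Proof.
move=> [sB cB].
have -> : #|E| = \sum_(S in B) #|edges S|.
  rewrite -sum1_card (eq_bigr (fun e => \sum_(S in B) (e \in edges S))); last first.
    by move=> e /cB <-; rewrite card_set_sum.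
  rewrite exchange_big /=; apply: eq_bigr => S /sB[_ SE].
  by rewrite -card_set_sum -{2}(setIidPr SE); apply: eq_card => e; rewrite !inE.
apply: dvdn_sum => S /sB[/star_cards[-> _] _]; exact: dvdnn.
Qed.

Lemma star_dec_peel k x E F B : is_edge_set F -> F \subset E ->
  (forall e, e \in F -> x \in e) -> #|F| = k ->
  star_dec k (E :\: F) B -> exists B', star_dec k E B'.
Proof.
move=> F2 FE xF Fk dB; have [S [kS SF]] := star_graph F2 xF Fk.
exists ([set S] :|: B); rewrite -(setID E F) (setIidPr FE) -SF.
apply: star_decU; [|exact: star_dec1|by rewrite SF].
rewrite -setI_eq0 SF; apply/eqP/setP => e.
by rewrite !inE; case: (e \in F); rewrite ?andbF.
Qed.

(** Splitting the out-edges of each vertex into groups of [k], one star at a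
    time: removing a star keeps all the out-degrees divisible by [k]. *)
Lemma oriented_star_dec k E (f : {set T} -> T) : 0 < k -> is_edge_set E ->
  (forall e, e \in E -> f e \in e) ->
  (forall x, k %| #|[set e in E | f e == x]|) ->
  exists B, star_dec k E B.
Proof.
move=> k0; move: {2}#|E| (leqnn #|E|) => m; elim: m E => [|m IH] E.
  by rewrite leqn0 cards_eq0 => /eqP-> *; exists set0; exact: star_dec0.
move=> Em E2 fE kE.
have [->|[e0 e0E]] := set_0Vmem E; first by exists set0; exact: star_dec0.
have [|F /subsetP FO Fk] := @subset_card_eq _ [set e in E | f e == f e0] k.
  by apply: dvdn_leq => //; apply/card_gt0P; exists e0; rewrite !inE e0E eqxx.
have FE : F \subset E by apply/subsetP => e /FO; rewrite inE => /andP[].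
have fF e : e \in F -> f e = f e0 by move=> /FO; rewrite inE => /andP[_ /eqP].
suff [B] : exists B, star_dec k (E :\: F) B.
  apply: (@star_dec_peel _ (f e0)) => //; first exact: is_edge_setS E2.
  by move=> e eF; rewrite -(fF _ eF) fE // (subsetP FE).
apply: IH.
- by have := cardsD E F; rewrite (setIidPr FE); lia.
- by apply: is_edge_setS E2; exact: subsetDl.
- by move=> e; rewrite inE => /andP[_ /fE].
- move=> x; have [<-|xe] := eqVneq (f e0) x.
    rewrite (_ : [set _ in _ | _] = [set e in E | f e == f e0] :\: F).
      rewrite cardsD (setIidPr _) ?Fk ?dvdn_sub //; exact/subsetP.
    by apply/setP => e; rewrite !inE andbA.
  rewrite (_ : [set _ in _ | _] = [set e in E | f e == x]) //.
  apply/setP => e; rewrite !inE; have [/fF->|//] := boolP (e \in F).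
  by rewrite (negbTE xe) ?andbF.
Qed.

(** A vertex of degree at least [k] is the centre of a further star, so that
    packing stars greedily only stops when all degrees are small. *)
Lemma small_degree_leave k E : 0 < k -> is_edge_set E ->
  exists L B, [/\ L \subset E, forall x, #|edges_at L x| < k & star_dec k (E :\: L) B].
Proof.
move=> k0; move: {2}#|E| (leqnn #|E|) => m; elim: m E => [|m IH] E Em E2.
  exists set0, set0; split; rewrite ?sub0set //; last first.
    by move: Em; rewrite leqn0 cards_eq0 => /eqP->; rewrite setD0; exact: star_dec0.
  by move=> x; rewrite eq_card0 // => e; rewrite !inE.
have [/forallP small|/forallPn[x]] := boolP [forall x, #|edges_at E x| < k].
  by exists E, set0; split => //; rewrite setDv; exact: star_dec0.
rewrite -leqNgt => /subset_card_eq[F /subsetP FO Fk].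
have FE : F \subset E by apply/subsetP => e /FO; rewrite inE => /andP[].
have [||L [B [LE small dB]]] := IH (E :\: F).
- by have := cardsD E F; rewrite (setIidPr FE); lia.
- by apply: is_edge_setS E2; exact: subsetDl.
have [||||B' dB'] := @star_dec_peel k x (E :\: L) F B _ _ _ Fk.
- exact: is_edge_setS E2.
- by move: LE; rewrite !subsetD FE disjoint_sym => /andP[].
- by move=> e /FO; rewrite inE => /andP[].
- by rewrite setDDl setUC -setDDl.
exists L, B'; split => //; exact: subset_trans LE (subsetDl _ _).
Qed.

Lemma star_dec_of_partial k U A : partial_star_decomposition k (complete_graph U) A ->
  let E := \bigcup_(S in A) edges S in star_dec k E A /\ E \subset pairs U.
Proof.
move=> [sA cA] E.
have EU : E \subset pairs U by apply/bigcupsP => S /sA[_ []].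
split=> //; split=> [S SA|e eE].
  by split; [case: (sA S SA) | apply: bigcup_sup].
apply/eqP; rewrite eqn_leq cA ?(subsetP EU) // card_gt0.
have /bigcupP[S SA eS] := eE.
by apply/set0Pn; exists S; rewrite inE SA.
Qed.

Lemma star_dec_complete k W B : 0 < k -> star_dec k (pairs W) B ->
  star_decomposition k (complete_graph W) B.
Proof.
move=> k0 [sB cB]; split=> // S /sB[kS SW]; split=> //; split=> //.
apply/subsetP => x /(mem_star_vertices k0 kS)[e /(subsetP SW)].
by rewrite in_pairs => /andP[/subsetP eW _] /eW.
Qed.

(** * Stars in the join of a graph with a complete graph *)

(** The criterion of [orientation] for the join, where a set of vertices is split
    into its old part [Y] and its new part [Q].  As the capacities add up to
    the number of edges, the out-degrees must equal them and are therefore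
    multiples of [k]. *)
Lemma join_star_dec (x0 : T) k U W L (c : T -> nat) : 0 < k -> U \subset W ->
  L \subset pairs U ->
  (forall Y Q, Y \subset U -> Q \subset W :\: U ->
    #|inner L Y| + #|Y| * #|Q| + 'C(#|Q|, 2) <= k * (\sum_(x in Y) c x + \sum_(x in Q) c x)) ->
  #|L| + #|U| * #|W :\: U| + 'C(#|W :\: U|, 2) =
    k * (\sum_(x in U) c x + \sum_(x in W :\: U) c x) ->
  exists B, star_dec k (L :|: (pairs W :\: pairs U)) B.
Proof.
move=> k0 UW LU H tot; set G := L :|: _.
have GW : G \subset pairs W.
  by rewrite subUset subsetDl (subset_trans LU) // pairsS.
have G2 : is_edge_set G := is_edge_setS GW (@pairs_edge_set W).
pose d x := k * ((x \in W) * c x).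
have dsum (S : {set T}) : \sum_(x in S) d x =
    k * (\sum_(x in S :&: U) c x + \sum_(x in S :&: (W :\: U)) c x).
  rewrite -big_distrr /=; congr (_ * _).
  rewrite (big_setID U) /=; congr (_ + _).
    by apply: eq_bigr => x; rewrite inE => /andP[_ /(subsetP UW)->]; rewrite mul1n.
  rewrite [LHS]big_mkcond [RHS]big_mkcond; apply: eq_bigr => x _; rewrite !inE.
  by case: (x \in U); case: (x \in S); case: (x \in W); rewrite ?mul1n.
have dG (S : {set T}) : #|inner G S| <= \sum_(x in S) d x.
  rewrite dsum; apply: leq_trans (H _ _ (subsetIr _ _) (subsetIr _ _)).
  have sub : inner G S \subset inner L (S :&: U) :|: (pairs (S :&: W) :\: pairs (S :&: U)).
    apply/subsetP => e eGS; have /andP[/setUP eG eS] : (e \in G) && (e \subset S).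
      by move: eGS; rewrite inE.
    apply/setUP; case: eG => [eL|eD]; [left|right].
      rewrite inE eL subsetI eS.
      by have := subsetP LU _ eL; rewrite in_pairs => /andP[->].
    by move: eD; rewrite !in_setD !in_pairs !subsetI eS.
  apply: leq_trans (subset_leq_card sub) _; rewrite -addnA.
  apply: leq_trans (leq_card_setU _ _) _; rewrite leq_add2l card_pairsD ?setIS //.
  rewrite (_ : S :&: W :\: S :&: U = S :&: (W :\: U)) //.
  by apply/setP => x; rewrite !inE; case: (x \in S); case: (x \in U); rewrite ?andbF ?andbT.
have [f [fe fd]] := orientation x0 G2 dG.
apply: (@oriented_star_dec k _ f) => // x.
have outE : forall x, #|[set e in G | f e == x]| = d x.
  have sums : \sum_x #|[set e in G | f e == x]| = \sum_x d x.
    transitivity #|G|.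
      under eq_bigr do rewrite card_set_sum.
      rewrite exchange_big /= -sum1_card; apply: eq_bigr => e _.
      rewrite (bigD1 (f e)) //= eqxx big1 // => y; rewrite eq_sym; by case: eqP.
    have := dsum setT; rewrite !setTI -tot (eq_bigl xpredT) ?inE // => [->|y]; last by rewrite inE.
    rewrite cardsU card_pairsD // addnA (_ : L :&: _ = set0) ?cards0 ?subn0 //.
    apply/setP => e; rewrite !inE; apply/negP => /and3P[/(subsetP LU)]; rewrite in_pairs => ->//.
  move=> y; have [_] := leqif_sum (P := xpredT) (fun i _ => leqif_eq (fd i)).
  by rewrite sums eqxx => /esym/forallP/(_ y)/eqP.
by rewrite outE dvdn_mulr.
Qed.

(** Convexity, used with [i] the number of new vertices in a vertex set: it
    leaves only the ends of an interval of sizes to be checked. *)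
Lemma quadratic_between (a b l i m : int) :
  (l <= i -> i <= m ->
  l * l + b * l + a <= 0 -> m * m + b * m + a <= 0 ->
  i * i + b * i + a <= 0)%R.
Proof.
move=> li im fl fm.
have [il|il] := eqVneq i l; first by rewrite il.
have lm : (0 < m - l)%R by lia.
have H : (0 <= (i - l) * (m - i) * (m - l))%R by rewrite !mulr_ge0; lia.
have H1 : ((m - i) * (l * l + b * l + a) <= 0)%R by apply: mulr_ge0_le0; lia.
have H2 : ((i - l) * (m * m + b * m + a) <= 0)%R by apply: mulr_ge0_le0; lia.
rewrite -(pmulr_rle0 _ lm); lia.
Qed.

(** The count behind [independent_dec]: [y] old vertices, of which [y'] are centre
    of a star, span [f] edges of the leave and are joined to [j] of the [s] new
    vertices, while [z] of the [n] old vertices are centre of no star.  The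
    right side is linear in [j], so that [j = 0] and [j = s] suffice; at [j = s]
    an old vertex left out contributes [s] edges to the total and costs at most
    [k <= s]. *)
Lemma uniform_count (k n s e z f y y' j : nat) :
  k <= s -> j <= s -> y <= n -> z <= n -> y <= y' + z -> f <= e -> f <= k * y' ->
  e + n * s + 'C(s, 2) = k * (n - z + s) ->
  f + y * j + 'C(j, 2) <= k * (y' + j).
Proof.
move=> ks js yn zn yz fe fy; have := double_bin2 s; have := double_bin2 j.
move: ('C(s, 2)) ('C(j, 2)) => cs cj dj ds tot.
suff : ((j%:Z * j + (2 * y%:Z - 1 - 2 * k%:Z) * j + (2 * f%:Z - 2 * k%:Z * y')) <= 0)%R by lia.
apply: (@quadratic_between _ _ 0 _ s); [lia|lia|lia|].
have : k * (n - z - y') <= k * (n - y) by rewrite leq_mul2l; lia.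
have : k * (n - y) <= s * (n - y) by rewrite leq_mul2r ks orbT.
nia.
Qed.

Lemma independent_dec (x0 : T) k U W L Z : 0 < k -> U \subset W -> L \subset pairs U ->
  (forall x, #|edges_at L x| < k) -> k <= #|W :\: U| ->
  Z \subset U -> inner L Z = set0 ->
  #|L| + #|U| * #|W :\: U| + 'C(#|W :\: U|, 2) = k * (#|U :\: Z| + #|W :\: U|) ->
  exists B, star_dec k (L :|: (pairs W :\: pairs U)) B.
Proof.
move=> k0 UW LU small ks ZU Zi tot.
have sumY Y : \sum_(x in Y) (x \notin Z) = #|Y :\: Z|.
  by rewrite -card_set_sum; apply: eq_card => x; rewrite !inE andbC.
have QZ Q : Q \subset W :\: U -> Q :\: Z = Q.
  move=> /subsetP QW; apply/setP => x; rewrite inE andbC.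
  have [/QW|//] := boolP (x \in Q); rewrite inE => /andP[xU _].
  by rewrite (contra _ xU) // => /(subsetP ZU).
apply: (@join_star_dec x0 k U W L (fun x => x \notin Z)) => //; last first.
  by rewrite !sumY (QZ (W :\: U)).
move=> Y Q YU QW; rewrite !sumY (QZ Q) //.
have fe : #|inner L Y| <= #|L| by apply/subset_leq_card/subsetP => e; rewrite inE => /andP[].
have fy : 1 * #|inner L Y| <= k.-1 * #|Y :\: Z|.
  apply: (small_degree_bound small); first by apply/subsetP => e; rewrite inE => /andP[].
  move=> e; rewrite inE => /andP[eL eY].
  have : e \notin inner L Z by rewrite Zi inE.
  rewrite inE eL /= => /subsetPn[x xe xZ]; rewrite card_gt0; apply/set0Pn; exists x.
  by rewrite !inE xe xZ (subsetP eY).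
have dZ := cardsD U Z; rewrite (setIidPr ZU) in dZ; have zn := subset_leq_card ZU.
have iY := cardsID Z Y; have iZ := subset_leq_card (subsetIr Y Z).
apply: (uniform_count (n := #|U|) (s := #|W :\: U|) (e := #|L|) (z := #|Z|)) => //.
- exact: subset_leq_card.
- exact: subset_leq_card.
- lia.
- move: fy; rewrite mul1n => /leq_trans; apply; rewrite leq_mul2r; lia.
- by rewrite -dZ.
Qed.

Section CriticalSize.

Local Open Scope ring_scope.

(** The balance at the bend, for [j = s - r].  The [y] old vertices span [f] edges
    of the leave, and [f] is at most [e] as well as at most [(k - 1) * y / 2].
    If [k <= j], all old vertices together are the worst case, and the claim
    reduces to [j * (2 * k - s) <= n * (k + 1)], where the left side is at most
    [k ^ 2].  If [2 * j <= k + 1], the old vertices only help.  In between, the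
    worst case is [y = 2 * f / (k - 1)] and [f = e]; as [q] and [e] determine
    each other affinely, it is enough to look at the two ends [q = 1] and
    [2 * e = (k - 1) * n]. *)
Lemma critical_size (k s n e q j y f : int) :
  2 <= k -> k + 1 <= n -> k <= s -> 0 < j -> j <= s -> 1 <= q ->
  2 * e <= (k - 1) * n -> y <= n -> 0 <= y -> f <= e -> 2 * f <= (k - 1) * y ->
  2 * k * (q * s + s - j) = 2 * e + 2 * n * (s - k) + s * (s - 1) ->
  2 * f + 2 * y * j + j * j <= 2 * k * y + 2 * k * q * j + j.
Proof.
move=> k2 kn ks j0 js q1 en yn y0 fe fy tot.
have key : j * (2 * k - s) <= n * (k + 1).
  apply: (@le_trans _ _ (k * k)); last by nia.
  have [sk|sk] := leP (2 * k) s; first by nia.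
  apply: (@le_trans _ _ (s * (2 * k - s))); first by nia.
  have := sqr_ge0 (s - k); lia.
have s0 : 0 < s by lia.
have [kj|jk] := leP k j.
  have Hn := mulr_ge0 (_ : 0 <= j - k) (_ : 0 <= n - y).
  have {Hn} : f + y * (j - k) <= e + n * (j - k) by nia.
  suff : 2 * e + 2 * n * (j - k) + j * j - j - 2 * k * q * j <= 0 by lia.
  rewrite -(pmulr_rle0 _ s0).
  have -> : s * (2 * e + 2 * n * (j - k) + j * j - j - 2 * k * q * j) =
            (s - j) * (2 * e - 2 * n * k + j * (2 * k - s)).
    have : j * (2 * k * (q * s + s - j)) =
           j * (2 * e + 2 * n * (s - k) + s * (s - 1)) by rewrite tot.
    lia.
  apply: mulr_ge0_le0; lia.
have [hj|hj] := leP (2 * j) (k + 1).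
  have : y * (2 * j - k - 1) <= 0 by nia.
  have : j * (j - 1) <= 2 * k * q * j by nia.
  lia.
have k1 : 0 < k - 1 by lia.
suff F : 2 * e * (2 * j - k - 1) <= j * (k - 1) * (2 * k * q - j + 1).
  have H1 : 2 * f * (k - j) <= (k - 1) * y * (k - j) by rewrite ler_wpM2r; lia.
  have H2 : 2 * f * (2 * j - k - 1) <= 2 * e * (2 * j - k - 1) by rewrite ler_wpM2r; lia.
  rewrite -subr_le0 -(pmulr_rle0 _ k1); lia.
set d := j * (k - 1) - s * (2 * j - k - 1).
have [d0|d0] := leP 0 d.
  (* The slack is nondecreasing in [q], so [e] is replaced by its value [e1]
     for [q = 1]. *)
  have H1 : 0 <= 2 * k * (q - 1) * d by rewrite !mulr_ge0; lia.
  set e1 := e - k * s * (q - 1).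
  have e1b : 2 * e1 <= 3 * k * k + k - 2 * k * j.
    have : 0 <= (n - k - 1) * (s - k) by rewrite mulr_ge0; lia.
    have : 0 <= (s - k) * (s - k) by rewrite mulr_ge0; lia.
    rewrite /e1; lia.
  have : 2 * e1 * (2 * j - k - 1) <= (3 * k * k + k - 2 * k * j) * (2 * j - k - 1).
    by rewrite ler_wpM2r; lia.
  have : 0 <= (3 * k + 1) * (k - j) * (k - j + 1).
    by rewrite !mulr_ge0; lia.
  rewrite /e1 /d in H1 *; lia.
(* Once [q] is expressed through [e], the slack decreases with [e], which is at
   most [(k - 1) * n / 2]. *)
rewrite -subr_ge0 -(pmulr_rge0 _ s0).
have H1 : 0 <= (k - 1) * (s - j) * (n * (k + 1) - j * (2 * k - s)) by rewrite !mulr_ge0; lia.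
have H2 : 0 <= ((k - 1) * n - 2 * e) * (- d) by rewrite mulr_ge0; lia.
have H3 : (j * (k - 1)) * (2 * k * (q * s + s - j)) =
          (j * (k - 1)) * (2 * e + 2 * n * (s - k) + s * (s - 1)) by rewrite tot.
rewrite /d in H2; lia.
Qed.

End CriticalSize.

(** The count behind [balanced_dec].  Among [i] new vertices, [p] are centre of
    [q + 1] stars and the others of [q]; at most [s - r] of them are of the
    latter kind, so that [p] is at least [i - (s - r)]. *)
Lemma balanced_count (k n s e q r f y i p : nat) :
  2 <= k -> k < n -> k <= s -> i <= s -> r < s -> 0 < q -> i + r <= s + p ->
  2 * e <= k.-1 * n -> y <= n -> f <= e -> 2 * f <= k.-1 * y ->
  e + n * s + 'C(s, 2) = k * (n + (q * s + r)) ->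
  f + y * i + 'C(i, 2) <= k * (y + (q * i + p)).
Proof.
move=> k2 kn ks si rs q0 ip en yn fe fy; have := double_bin2 s; have := double_bin2 i.
move: ('C(s, 2)) ('C(i, 2)) => cs ci di ds tot.
have [J sJ] : exists J, s = J + r by exists (s - r); lia.
have crit : (2 * f%:Z + 2 * y%:Z * J + J%:Z * J
   <= 2 * k%:Z * y + 2 * k%:Z * q * J + J)%R.
  by apply: (@critical_size k s n e q J y f); try lia; nia.
have kq : k <= k * q by rewrite leq_pmulr.
have ky : k.-1 * y <= 2 * (k * y) by nia.
have tot2 : 2 * e + 2 * (n * s) + s * s = 2 * (k * n) + 2 * (k * q * s) + 2 * (k * r) + s by lia.
have fin : s * (2 * y) + 2 * f + 2 * (k * n) <= 2 * e + 2 * (n * s) + 2 * (k * y).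
  have [w nw] : exists w, n = y + w by exists (n - y); lia.
  have : k * w <= s * w by rewrite leq_mul2r ks orbT.
  by rewrite nw; lia.
have [i_small|i_large] := leqP (i + r) s.
  suff : ((i%:Z * i + (2 * y%:Z - 1 - 2 * k%:Z * q) * i + (2 * f%:Z - 2 * k%:Z * y)) <= 0)%R by lia.
  by apply: (@quadratic_between _ _ 0 _ J); lia.
have [w iw] : exists w, i = J + w by exists (i - J); lia.
have kp : k * w <= k * p by rewrite leq_mul2l; lia.
suff : ((i%:Z * i + (2 * y%:Z - 1 - 2 * k%:Z * (q%:Z + 1)) * i
   + (2 * f%:Z - 2 * k%:Z * y + 2 * k%:Z * J)) <= 0)%R by rewrite iw; lia.
by apply: (@quadratic_between _ _ J _ s%:Z); lia.
Qed.

Lemma balanced_dec (x0 : T) k U W L q r : 2 <= k -> U \subset W -> L \subset pairs U ->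
  (forall x, #|edges_at L x| < k) -> k <= #|W :\: U| -> k < #|U| ->
  0 < q -> r < #|W :\: U| ->
  #|L| + #|U| * #|W :\: U| + 'C(#|W :\: U|, 2) = k * (#|U| + (q * #|W :\: U| + r)) ->
  exists B, star_dec k (L :|: (pairs W :\: pairs U)) B.
Proof.
move=> k2 UW LU small ks kn q0 rs tot.
have L2 : is_edge_set L := is_edge_setS LU (@pairs_edge_set U).
have [P /subsetP PW Pr] := @subset_card_eq _ (W :\: U) r (ltnW rs).
pose c x := if x \in U then 1 else q + (x \in P).
have sumY Y : Y \subset U -> \sum_(x in Y) c x = #|Y|.
  by move=> /subsetP YU; rewrite -sum1_card; apply: eq_bigr => x /YU; rewrite /c => ->.
have sumQ Q : Q \subset W :\: U -> \sum_(x in Q) c x = q * #|Q| + #|Q :&: P|.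
  move=> /subsetP QW; rewrite mulnC -sum_nat_const.
  rewrite (_ : #|Q :&: P| = \sum_(x in Q) (x \in P)); last first.
    by rewrite -card_set_sum; apply: eq_card => x; rewrite !inE.
  rewrite -big_split /=; apply: eq_bigr => x /QW; rewrite inE /c.
  by case: (x \in U).
apply: (@join_star_dec x0 k U W L c) => //; [lia| |]; last first.
  rewrite sumY // sumQ // tot (setIidPr _) ?Pr //; exact/subsetP.
move=> Y Q YU QW; rewrite sumY // sumQ //.
have YL : inner L Y \subset L by apply/subsetP => e; rewrite inE => /andP[].
apply: (balanced_count (n := #|U|) (s := #|W :\: U|) (e := #|L|) (r := r)) => //.
- exact: subset_leq_card.
- have := cardsUI Q P; have : #|Q :|: P| <= #|W :\: U|.
    by apply: subset_leq_card; rewrite subUset QW; exact/subsetP.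
  lia.
- apply: (small_degree_bound small) => // e eL.
  have := subsetP LU _ eL; rewrite in_pairs => /andP[/setIidPl-> /eqP->] //.
- exact: subset_leq_card.
- exact: subset_leq_card.
- apply: (small_degree_bound small) => // e; rewrite inE => /andP[eL /setIidPl->].
  by rewrite L2.
Qed.

(** With [m = sqrt (2 * k)], the hypothesis on [n] says that [k * (k - 1)] is less
    than [n * (2 * m - 1)], which is the left side of the tangent bound. *)
Lemma sqrt_bound (R : rcfType) (k n z e : nat) : 2 <= k ->
  (k%:R * (k%:R - 1) / (Num.sqrt (8 * k%:R) - 1) < n%:R :> R)%R ->
  (let m := Num.sqrt (2 * k%:R) : R in
    (2 * m - 1) * n%:R <= m * m * z%:R + 2 * e%:R)%R ->
  k * k < 2 * k * z + 2 * e + k.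
Proof.
move=> k2 hn /=; set m := Num.sqrt _ => hm.
have mm : (m * m = 2 * k%:R)%R by rewrite -expr2 sqr_sqrtr // mulr_ge0.
have m8 : Num.sqrt (8 * k%:R : R)%R = (2 * m)%R.
  rewrite (_ : 8 * k%:R = 2 ^+ 2 * (2 * k%:R))%R; last by ring.
  by rewrite sqrtrM ?sqr_ge0 // sqrtr_sqr ger0_norm.
have m1 : (1 <= m)%R.
  rewrite -sqrtr1 ler_sqrt; last by rewrite mulr_ge0.
  have : (2 <= k%:R :> R)%R by rewrite ler_nat.
  lra.
rewrite m8 ltr_pdivrMr in hn; last by lra.
rewrite mm in hm.
rewrite -(ltr_nat R) !natrD !natrM.
move: hn hm; move: (k%:R)%R (n%:R)%R (z%:R)%R (e%:R)%R => k' n' z' e'; lra.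
Qed.

(** The number [K] of stars decides between one star per vertex outside an
    independent set, and one star per old vertex. *)
Lemma leave_join_star_dec (R : rcfType) k U W L : 2 <= k ->
  (k%:R * (k%:R - 1) / (Num.sqrt (8 * k%:R) - 1) < #|U|%:R :> R)%R ->
  U \subset W -> k < #|U| -> k <= #|W :\: U| -> L \subset pairs U ->
  (forall x, #|edges_at L x| < k) ->
  k %| #|L| + #|U| * #|W :\: U| + 'C(#|W :\: U|, 2) ->
  exists B, star_dec k (L :|: (pairs W :\: pairs U)) B.
Proof.
move=> k2 hn UW kn ks LU small /dvdnP[K tot].
have /card_gt0P[x0 _] : 0 < #|U| by lia.
have L2 : is_edge_set L := is_edge_setS LU (@pairs_edge_set U).
have nK : #|U| <= K.
  have H : k * #|U| <= #|U| * #|W :\: U| by rewrite mulnC leq_mul2l ks orbT.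
  rewrite -(leq_pmul2l (ltnW k2)); lia.
have [small_K|large_K] := leqP K (#|U| + #|W :\: U|).
  have [Z [ZU Zi]] := turan_tangent (Num.sqrt (2 * k%:R : R)) U L2.
  rewrite (_ : inner L U = L); last first.
    apply/setP => e; rewrite inE andb_idr // => /(subsetP LU).
    by rewrite in_pairs => /andP[].
  move=> /(sqrt_bound k2 hn) dense.
  (* [Z] has enough vertices to leave out: otherwise
     [k * (z + K + 1) <= k * (n + s)], and with [s = k + t] the definition of
     [K] and the bound on [z] leave [2 * n * t + t ^ 2 < t], which is false. *)
  have [|Z0 Z0Z Z0c] := @subset_card_eq _ Z (#|U| + #|W :\: U| - K).
    have := double_bin2 #|W :\: U|; move: tot dense nK small_K kn ks.
    move: #|W :\: U| #|U| #|L| #|Z| ('C(_, _)) => s n e z c; clear -k2.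
    move=> tot dense nK sK kn ks bs.
    have [t st] : exists t, s = k + t by exists (s - k); lia.
    rewrite leqNgt; apply/negP => lt_z.
    have H1 : k * (z + K).+1 <= k * (n + s) by rewrite leq_mul2l; lia.
    have H2 : k * t + t <= n * t by nia.
    nia.
  apply: (@independent_dec x0 k U W L Z0) => //; first lia.
  - exact: subset_trans ZU.
  - apply/setP => e; rewrite [RHS]inE; apply/negP; rewrite inE => /andP[eL eZ].
    have : e \in inner L Z by rewrite inE eL (subset_trans eZ).
    by rewrite Zi inE.
  - rewrite tot mulnC; congr (_ * _).
    have := cardsD U Z0; rewrite (setIidPr (subset_trans Z0Z ZU)).
    have := subset_leq_card (subset_trans Z0Z ZU); lia.
have s0 : 0 < #|W :\: U| by lia.
apply: (@balanced_dec x0 k U W L ((K - #|U|) %/ #|W :\: U|) ((K - #|U|) %% #|W :\: U|)) => //.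
- rewrite divn_gt0 //; lia.
- by rewrite ltn_pmod.
- by rewrite -divn_eq tot mulnC subnKC.
Qed.

End EdgeSets.

Local Notation pairs U := (edges (complete_graph U)).

Theorem theorem3 (R : rcfType) (k n : nat)
  (hk : 2 <= k)
  (hn : (k%:R * (k%:R - 1) / (Num.sqrt (8 * k%:R) - 1) < n%:R :> R)%R)
  (T : finType) (U : {set T}) (hU : #|U| = n)
  (A : {set graph T})
  (hA : partial_star_decomposition k (complete_graph U) A)
  (hA0 : A != set0)
  (s : nat) (hs : k <= s) (hmod : 'C(n + s, 2) = 0 %[mod k])
  (W : {set T}) (hUW : U \subset W) (hW : #|W| = n + s) :
  exists B : {set graph T},
    star_decomposition k (complete_graph W) B /\
    is_embedding k (complete_graph U) A (complete_graph W) B.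
Proof.
have k0 : 0 < k by lia.
have sW : #|W :\: U| = s by rewrite cardsD (setIidPr hUW) hU hW addKn.
have kn : k < #|U|.
  have /set0Pn[S SA] := hA0; have [kS [VS _]] := hA.1 S SA.
  by have [_ <-] := star_cards kS; exact: subset_leq_card.
have [decA EU] := star_dec_of_partial hA; set E := \bigcup_(S in A) _ in decA EU.
have [|L [B1 [LE small dec1]]] := @small_degree_leave _ k (pairs U :\: E) k0.
  exact: is_edge_setS (subsetDl _ _) (@pairs_edge_set _ U).
have LU : L \subset pairs U := subset_trans LE (subsetDl _ _).
have decAB : star_dec k (pairs U :\: L) (A :|: B1).
  rewrite (_ : pairs U :\: L = E :|: ((pairs U :\: E) :\: L)).
    apply: star_decU decA dec1; rewrite -setI_eq0; apply/eqP/setP => e.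
    by rewrite !in_setI !in_setD in_set0; case: (e \in E); rewrite ?andbF.
  apply/setP => e; rewrite !in_setU !in_setD; have [eE|//] := boolP (e \in E).
  rewrite (subsetP EU) //= andbT; apply/negP => /(subsetP LE).
  by rewrite in_setD eE.
have [|||B2 dec2] := @leave_join_star_dec _ R k U W L hk _ hUW kn _ LU small.
- by rewrite hU.
- by rewrite sW.
- have -> : #|L| + #|U| * #|W :\: U| + 'C(#|W :\: U|, 2) = #|pairs W| - #|pairs U :\: L|.
    rewrite -addnA -card_pairsD // !cardsD (setIidPr LU) (setIidPr (pairsS hUW)).
    have := subset_leq_card LU; have := subset_leq_card (pairsS hUW); lia.
  rewrite dvdn_sub //; last exact: star_dec_dvd decAB.
  by rewrite card_pairs hW /dvdn hmod mod0n.
have dec : star_dec k (pairs W) (A :|: B1 :|: B2).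
  rewrite (_ : pairs W = (pairs U :\: L) :|: (L :|: (pairs W :\: pairs U))).
    apply: star_decU decAB dec2; rewrite -setI_eq0; apply/eqP/setP => e.
    rewrite in_setI in_setU !in_setD in_set0.
    by case: (e \in L); case: (e \in pairs U); rewrite ?andbF.
  apply/setP => e; rewrite !in_setU !in_setD; have := subsetP (pairsS hUW) e.
  have := subsetP LU e; case: (e \in L) => [/(_ isT) -> /(_ isT) //|_].
  by case: (e \in pairs U) => [/(_ isT)|_].
have decW := star_dec_complete k0 dec.
exists (A :|: B1 :|: B2); split=> //; split.
- by split=> [S /decW.1//|e /decW.2->].
- by rewrite -setUA subsetUl.
- by split=> //; exact: pairsS.
Qed.
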